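(* Let $\Bbbk$ be a field, $V$ a finite-dimensional $\Bbbk$-vector space with $\dim V>1$, and $R$ a Hecke symmetry on $V$ with parameter $q$. Suppose that $\dim\Lambda_n(V,R)=1$ for some integer $n>0$. Then $\Lambda_i(V,R)=0$ for all $i>n$, and the algebra $\Lambda(V,R)$ is a Frobenius algebra.
   Context: A Hecke symmetry on $V$ with parameter $0\neq q\in\Bbbk$ is a linear map $R:V\otimes V\to V\otimes V$ satisfying the braid equation $(R\otimes\mathrm{Id}_V)(\mathrm{Id}_V\otimes R)(R\otimes\mathrm{Id}_V)=(\mathrm{Id}_V\otimes R)(R\otimes\mathrm{Id}_V)(\mathrm{Id}_V\otimes R)$ and the Hecke relation $(R-q\,\mathrm{Id}_{V\otimes V})(R+\mathrm{Id}_{V\otimes V})=0$ (the value $q=-1$ is allowed; no other restriction on $q$, in particular $q$ may be a root of unity). $\Lambda(V,R)$ denotes the graded algebra obtained as the quotient of the tensor algebra $\mathbb{T}(V)$ by the two-sided ideal generated by $\mathrm{Ker}(R-q\,\mathrm{Id})\subset V^{\otimes 2}$, and $\Lambda_i(V,R)$ is its homogeneous component of degree $i$. *)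

(* Defs.v *)
(* V = k^d with its standard basis e_0,...,e_(d-1).
   The tensor algebra T(V) is modelled as the free algebra on d letters:
   a tensor is a coefficient function on words (seq 'I_d); the word
   [:: i1; ...; im] stands for e_i1 (x) ... (x) e_im, and its degree is its length. *)
From Stdlib Require List.
From mathcomp Require Import all_boot all_order all_algebra.
Set Implicit Arguments. Unset Strict Implicit. Unset Printing Implicit Defensive.
Import GRing.Theory.
Local Open Scope ring_scope.

Section Defs.
Variables (k : fieldType) (d : nat).

(* elements of T(V) (finitely supported ones are those that are [bounded]) *)
Definition tens := seq 'I_d -> k.
Definition bounded (f : tens) (N : nat) := forall w : seq 'I_d, (N < size w)%N -> f w = 0.
Definition homog (f : tens) (i : nat) := forall w : seq 'I_d, size w != i -> f w = 0.
Definition tmul (f g : tens) : tens :=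
  fun w => \sum_(i < (size w).+1) f (take i w) * g (drop i w).

(* A linear map R : V(x)V -> V(x)V in the standard basis:
   R (e_i (x) e_j) = \sum_(a,b) Rc i j a b  e_a (x) e_b.
   Elements of V(x)V are coefficient functions x : 'I_d -> 'I_d -> k. *)
Definition applyR (Rc : 'I_d -> 'I_d -> 'I_d -> 'I_d -> k) (x : 'I_d -> 'I_d -> k)
  : 'I_d -> 'I_d -> k :=
  fun a b => \sum_(i < d) \sum_(j < d) x i j * Rc i j a b.
Definition R12 (Rc : 'I_d -> 'I_d -> 'I_d -> 'I_d -> k) (t : 'I_d -> 'I_d -> 'I_d -> k)
  : 'I_d -> 'I_d -> 'I_d -> k :=
  fun x y z => \sum_(a < d) \sum_(b < d) t a b z * Rc a b x y.
Definition R23 (Rc : 'I_d -> 'I_d -> 'I_d -> 'I_d -> k) (t : 'I_d -> 'I_d -> 'I_d -> k)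
  : 'I_d -> 'I_d -> 'I_d -> k :=
  fun x y z => \sum_(b < d) \sum_(c < d) t x b c * Rc b c y z.

Definition hecke_symmetry (Rc : 'I_d -> 'I_d -> 'I_d -> 'I_d -> k) (q : k) : Prop :=
  [/\ q != 0,
      (forall t x y z, R12 Rc (R23 Rc (R12 Rc t)) x y z = R23 Rc (R12 Rc (R23 Rc t)) x y z)
    & (forall (t : 'I_d -> 'I_d -> k) a b,
        let s := fun i j => applyR Rc t i j + t i j in
        applyR Rc s a b - q * s a b = 0)].

Definition kerRq (Rc : 'I_d -> 'I_d -> 'I_d -> 'I_d -> k) (q : k) (x : 'I_d -> 'I_d -> k) :=
  forall a b, applyR Rc x a b = q * x a b.

Definition sandwich (u : seq 'I_d) (x : 'I_d -> 'I_d -> k) (v : seq 'I_d) : tens :=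
  fun w => \sum_(i < d) \sum_(j < d) x i j * (w == u ++ i :: j :: v)%:R.

(* membership in the two-sided ideal of T(V) generated by Ker(R - q Id):
   finite sums of u (x) x (x) v with x in the kernel (scalars are absorbed in x) *)
Definition in_ideal (Rc : 'I_d -> 'I_d -> 'I_d -> 'I_d -> k) (q : k) (f : tens) : Prop :=
  exists s : seq (seq 'I_d * ('I_d -> 'I_d -> k) * seq 'I_d),
    (forall t, List.In t s -> kerRq Rc q t.1.2) /\
    (forall w, f w = \sum_(t <- s) sandwich t.1.1 t.1.2 t.2 w).

Definition Lambda_zero Rc q (i : nat) : Prop :=
  forall f, homog f i -> in_ideal Rc q f.
Definition Lambda_dim1 Rc q (n : nat) : Prop :=
  exists e : tens, [/\ homog e n, ~ in_ideal Rc q e &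
    forall f, homog f n -> exists c : k, in_ideal Rc q (fun w => f w - c * e w)].

Definition phiN (c : seq 'I_d -> k) (N : nat) (f : tens) : k :=
  \sum_(i < N.+1) \sum_(w : i.-tuple 'I_d) c (val w) * f (val w).

(* T(V)/I is a Frobenius algebra: it is finite-dimensional, and there is a
   linear form phi on T(V)/I (a linear form on T(V) vanishing on I) whose
   associated bilinear form (a,b) |-> phi(ab) is nondegenerate. *)
Definition frobenius_quot (I : tens -> Prop) : Prop :=
  (exists s : seq tens, (forall t, List.In t s -> exists N, bounded t N) /\
     forall a N, bounded a N -> exists cs : seq k,
       I (fun w => a w - \sum_(p <- zip cs s) p.1 * p.2 w)) /\
  exists c : seq 'I_d -> k,
    (forall f N, bounded f N -> I f -> phiN c N f = 0) /\
    (forall a Na, bounded a Na -> ~ I a ->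
       (exists b Nb, bounded b Nb /\ phiN c (Na + Nb) (tmul a b) != 0) /\
       (exists b Nb, bounded b Nb /\ phiN c (Nb + Na) (tmul b a) != 0)).

End Defs.

(* Main.v *)
(* Put S = - R / q.  It is a braiding with Ker (R - q) = Ker (1 + S),
   so the braided coproduct of T(V) for which letters are primitive descends to Lambda.
   In T(V) # T(V) one has (1 # v) Delta x = Delta (v x) - (v # 1) Delta x for a letter v;
   iterating, (1 # y) Delta x is, for y of degree n, a combination of (y'' # 1) Delta (y' x)
   with deg y' + deg y'' = n.  If x has degree t and Lambda_(n-t) x = 0, all these terms
   vanish in Lambda # Lambda_n, and the component of (1 # y) (x # 1) in Lambda_t # Lambda_n
   is the braiding of y # x.  The braiding being invertible and Lambda_n nonzero, x = 0.
   So multiplication into Lambda_n is a nondegenerate pairing; reversing words gives the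
   other side.  With dim Lambda_n = 1 < dim V, nondegeneracy in degree 1 then forces
   Lambda_(n+1) = 0.

   Everything is dualized: Lambda is handled through the linear forms on T(V) (functions on
   words) that annihilate the ideal. *)
From Stdlib Require Import FunctionalExtensionality Classical.
Require Import Defs.
From mathcomp Require Import all_boot all_order all_algebra zify ring.
Set Implicit Arguments. Unset Strict Implicit. Unset Printing Implicit Defensive.
Import GRing.Theory.
Local Open Scope ring_scope.

Lemma funext2 T U V (f g : T -> U -> V) : (forall x y, f x y = g x y) -> f = g.
Proof. by move=> fg; do 2![apply: functional_extensionality => ?]. Qed.

Lemma funext3 T U V W (f g : T -> U -> V -> W) :
  (forall x y z, f x y z = g x y z) -> f = g.
Proof. by move=> fg; do 3![apply: functional_extensionality => ?]. Qed.

(** * Linear forms annihilating the relations *)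

Section Annihilators.
Variables (k : fieldType) (d : nat).
Notation word := (seq 'I_d).
Notation tensor2 := ('I_d -> 'I_d -> k).
Notation tensor3 := ('I_d -> 'I_d -> 'I_d -> k).

(** The dual of the quotient of T(V) by the two-sided ideal generated by [K], each form being
    encoded by its values on words. No support condition is imposed, so this is the full dual and
    not the graded one. *)
Definition annihilates (K : tensor2 -> Prop) (f : word -> k) : Prop :=
  forall u v r, K r -> \sum_a \sum_b r a b * f (u ++ a :: b :: v) = 0.

(** The dual of the tensor square of the same quotient. *)
Definition biannihilates (K : tensor2 -> Prop) (h : word -> word -> k) : Prop :=
  (forall v, annihilates K (h^~ v)) /\ (forall u, annihilates K (h u)).

Definition braiding (S : 'I_d -> 'I_d -> 'I_d -> 'I_d -> k) : Prop :=
  forall t x y z, R12 S (R23 S (R12 S t)) x y z = R23 S (R12 S (R23 S t)) x y z.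

Definition antisym (S : 'I_d -> 'I_d -> 'I_d -> 'I_d -> k) (r : tensor2) : Prop :=
  forall a b, applyR S r a b = - r a b.

Lemma annihilates_catl K f u : annihilates K f -> annihilates K (fun w => f (u ++ w)).
Proof.
move=> Kf u' v r Kr; rewrite -[RHS](Kf (u ++ u') v r Kr).
by apply: eq_bigr => a _; apply: eq_bigr => b _; rewrite -!catA.
Qed.

Lemma annihilates_catr K f v : annihilates K f -> annihilates K (fun w => f (w ++ v)).
Proof.
move=> Kf u v' r Kr; rewrite -[RHS](Kf u (v' ++ v) r Kr).
by apply: eq_bigr => a _; apply: eq_bigr => b _; rewrite -!catA.
Qed.

Lemma annihilates_sum K (I : finType) (c : I -> k) (f : I -> word -> k) :
  (forall i, annihilates K (f i)) -> annihilates K (fun w => \sum_i c i * f i w).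
Proof.
move=> Kf u v r Kr.
under eq_bigr => a _ do under eq_bigr => b _ do rewrite mulr_sumr.
under eq_bigr => a _ do rewrite exchange_big /=.
rewrite exchange_big big1 //= => i _.
rewrite -[RHS](mulr0 (c i)) -[in RHS](Kf i u v r Kr) mulr_sumr.
apply: eq_bigr => a _; rewrite mulr_sumr; apply: eq_bigr => b _.
by rewrite mulrCA.
Qed.

(** * Transposes of the braiding and the braid relation *)

Definition pairing3 (t X : tensor3) : k := \sum_x \sum_y \sum_z t x y z * X x y z.

Definition dual12 S (X : tensor3) : tensor3 :=
  fun a b z => \sum_x \sum_y S a b x y * X x y z.
Definition dual23 S (X : tensor3) : tensor3 :=
  fun x b c => \sum_y \sum_z S b c y z * X x y z.

Lemma applyR_dual S (t X : tensor2) :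
  \sum_x \sum_y applyR S t x y * X x y
  = \sum_a \sum_b t a b * \sum_x \sum_y S a b x y * X x y.
Proof.
rewrite /applyR !pair_bigA /=.
under eq_bigr do rewrite pair_bigA mulr_suml /=.
rewrite exchange_big; apply: eq_bigr => p _ /=.
rewrite pair_bigA mulr_sumr; apply: eq_bigr => r _.
by rewrite mulrA.
Qed.

Lemma pairing3_R12 S t X : pairing3 (R12 S t) X = pairing3 t (dual12 S X).
Proof.
rewrite /pairing3; under eq_bigr do rewrite exchange_big.
under [RHS]eq_bigr do rewrite exchange_big.
rewrite exchange_big [RHS]exchange_big; apply: eq_bigr => z _.
exact: (applyR_dual S (fun x y => t x y z) (fun x y => X x y z)).
Qed.

Lemma pairing3_R23 S t X : pairing3 (R23 S t) X = pairing3 t (dual23 S X).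
Proof. by apply: eq_bigr => x _; exact: (applyR_dual S (t x) (X x)). Qed.

Lemma R12N S (t : tensor3) :
  R12 S (fun x y z => - t x y z) = fun x y z => - R12 S t x y z.
Proof.
apply: funext3 => x y z; rewrite /R12 -sumrN.
by apply: eq_bigr => a _; rewrite -sumrN; apply: eq_bigr => b _; rewrite mulNr.
Qed.

Lemma R23N S (t : tensor3) :
  R23 S (fun x y z => - t x y z) = fun x y z => - R23 S t x y z.
Proof.
apply: funext3 => x y z; rewrite /R23 -sumrN.
by apply: eq_bigr => a _; rewrite -sumrN; apply: eq_bigr => b _; rewrite mulNr.
Qed.

(** By the braid relation, S_23 S_12 carries V (x) Ker (1 + S) into Ker (1 + S) (x) V; [t] is the
    image of e_a (x) r. *)
Lemma pairing3_antisym23 S a r X : braiding S -> antisym S r ->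
  exists2 t : tensor3, (forall z, antisym S (fun x y => t x y z)) &
    \sum_b \sum_c r b c * dual12 S (dual23 S X) a b c = pairing3 t X.
Proof.
move=> yb Sr; pose t0 := fun x y z => (x == a)%:R * r y z : k.
have t0E : R23 S t0 = fun x y z => - t0 x y z.
  apply: funext3 => x y z; rewrite /t0 -mulrN -Sr mulr_sumr.
  by apply: eq_bigr => b _; rewrite mulr_sumr; apply: eq_bigr => c _; rewrite mulrA.
exists (R23 S (R12 S t0)).
  by move=> z x y; move: (yb t0 x y z); rewrite t0E R12N R23N.
rewrite pairing3_R23 pairing3_R12 /pairing3 [RHS](bigD1 a) //= [X in _ = _ + X]big1 ?addr0.
  by apply: eq_bigr => b _; apply: eq_bigr => c _; rewrite /t0 eqxx mul1r.
by move=> x /negPf nxa; do 2![apply: big1 => ? _]; rewrite /t0 nxa !mul0r.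
Qed.

(** Symmetrically, S_12 S_23 carries Ker (1 + S) (x) V into V (x) Ker (1 + S); [t] is the image of r
    (x) e_c. *)
Lemma pairing3_antisym12 S c r X : braiding S -> antisym S r ->
  exists2 t : tensor3, (forall x, antisym S (t x)) &
    \sum_a \sum_b r a b * dual23 S (dual12 S X) a b c = pairing3 t X.
Proof.
move=> yb Sr; pose t0 := fun x y z => r x y * (z == c)%:R : k.
have t0E : R12 S t0 = fun x y z => - t0 x y z.
  apply: funext3 => x y z; rewrite /t0 -mulNr -Sr mulr_suml.
  by apply: eq_bigr => b _; rewrite mulr_suml; apply: eq_bigr => ? _; rewrite mulrAC.
exists (R12 S (R23 S t0)).
  by move=> x y z; move: (yb t0 x y z); rewrite t0E R23N R12N.
rewrite pairing3_R12 pairing3_R23 /pairing3.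
apply: eq_bigr => a _; apply: eq_bigr => b _.
rewrite [RHS](bigD1 c) //= [X in _ = _ + X]big1 ?addr0 /t0 ?eqxx ?mulr1 //.
by move=> z /negPf nzc; rewrite nzc mulr0 mul0r.
Qed.

(* A function [h] of two words is a linear form on T(V) # T(V), whose product is braided by
   [S].  [lmul a h] and [rmul S a h] are [h] composed with left multiplication by [a # 1] and
   [1 # a]; [comul S h] is [h] composed with the coproduct, and [cross S h w u] is
   [h ((1 # w) (u # 1))], i.e. [h] composed with the braiding. *)
Definition lmul (a : 'I_d) (h : word -> word -> k) : word -> word -> k :=
  fun u v => h (a :: u) v.

Fixpoint rmul S (a : 'I_d) (h : word -> word -> k) (u v : word) {struct u} : k :=
  if u is b :: u' then \sum_x \sum_y S a b x y * rmul S y (lmul x h) u' v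
  else h [::] (a :: v).

Fixpoint comul S (h : word -> word -> k) (w : word) : k :=
  if w is a :: w' then comul S (fun u v => lmul a h u v + rmul S a h u v) w'
  else h [::] [::].

Fixpoint cross S (F : word -> word -> k) (w u : word) : k :=
  if w is a :: w' then cross S (rmul S a F) w' u else F u [::].

(** * Linearity of the braided operations *)

Lemma rmul_sum S (I : finType) (c : I -> k) (H : I -> word -> word -> k) a :
  rmul S a (fun u v => \sum_i c i * H i u v) = fun u v => \sum_i c i * rmul S a (H i) u v.
Proof.
apply: funext2 => u v.
elim: u a H => [//|b u IH] a H /=.
under [LHS]eq_bigr => x _ do under eq_bigr => y _ do
  rewrite (IH y (fun i => lmul x (H i))) mulr_sumr.
under [LHS]eq_bigr => x _ do rewrite exchange_big.
rewrite exchange_big; apply: eq_bigr => i _ /=.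
rewrite mulr_sumr; apply: eq_bigr => x _; rewrite mulr_sumr; apply: eq_bigr => y _.
by rewrite mulrCA.
Qed.

Lemma rmul0 S a u v : rmul S a (fun _ _ => 0) u v = 0.
Proof.
elim: u a => [//|b u IH] a /=; apply: big1 => x _; apply: big1 => y _.
by rewrite IH mulr0.
Qed.

Lemma rmulD S a g h u v :
  rmul S a (fun u v => g u v + h u v) u v = rmul S a g u v + rmul S a h u v.
Proof.
have sumE (f : bool -> k) : \sum_b 1 * f b = f true + f false by rewrite big_bool !mul1r.
rewrite -[RHS](sumE (fun b => rmul S a (if b then g else h) u v)).
have <- := f_equal (fun f => f u v)
  (rmul_sum S (fun=> 1) (fun b : bool => if b then g else h) a).
by congr (rmul S a _ u v); apply: funext2 => ? ?; rewrite sumE.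
Qed.

Lemma comul_sum S (I : finType) (c : I -> k) (H : I -> word -> word -> k) w :
  comul S (fun u v => \sum_i c i * H i u v) w = \sum_i c i * comul S (H i) w.
Proof.
elim: w H => [//|a w IH] H /=; rewrite -IH; congr (comul S _ w).
apply: funext2 => u v.
by rewrite rmul_sum /lmul -big_split; apply: eq_bigr => i _; rewrite mulrDr.
Qed.

Lemma cross_sum S (I : finType) (c : I -> k) (H : I -> word -> word -> k) w u :
  cross S (fun u v => \sum_i c i * H i u v) w u = \sum_i c i * cross S (H i) w u.
Proof. by elim: w H => [//|a w IH] H /=; rewrite rmul_sum IH. Qed.

Lemma comul0 S w : comul S (fun _ _ => 0) w = 0.
Proof.
elim: w => //= a w IH; rewrite -[RHS]IH; congr (comul S _ w).
by apply: funext2 => u v; rewrite rmul0 /lmul addr0.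
Qed.

Lemma cross0 S w u : cross S (fun _ _ => 0) w u = 0.
Proof.
elim: w => //= a w IH; rewrite -[RHS]IH; congr (cross S _ w u).
by apply: funext2 => ? ?; rewrite rmul0.
Qed.

Lemma rmul_sum2 S a u v b (G : 'I_d -> 'I_d -> word -> word -> k) :
  rmul S a (fun u v => \sum_x \sum_y b x y * G x y u v) u v
  = \sum_x \sum_y b x y * rmul S a (G x y) u v.
Proof.
rewrite pair_bigA /= -(f_equal (fun f => f u v)
  (rmul_sum S (fun p => b p.1 p.2) (fun p => G p.1 p.2) a)) /=.
by congr (rmul S a _ u v); apply: funext2 => ? ?; rewrite pair_bigA.
Qed.

(** * Descent of the braided operations to the quotient *)

Section Stability.
Variables (S : 'I_d -> 'I_d -> 'I_d -> 'I_d -> k) (K : tensor2 -> Prop).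
Hypotheses (S_braid : braiding S) (K_antisym : forall r, K r <-> antisym S r).

(** When [a] crosses the two letters of a relation [r], the tensor e_a (x) r becomes an element of K
    (x) V, so a relation still reaches the left argument of [h]. *)
Lemma annihilates_rmul_l a h : (forall v, annihilates K (h^~ v)) ->
  forall v, annihilates K ((rmul S a h)^~ v).
Proof.
move=> Kh v u1 u2 r Kr; elim: u1 a h Kh => [|c u1 IH] a h Kh /=; last first.
  under eq_bigr => x _ do under eq_bigr => y _ do rewrite mulr_sumr.
  under eq_bigr => x _ do rewrite exchange_big.
  rewrite exchange_big big1 //= => x _.
  under eq_bigr => b _ do under eq_bigr => b' _ do rewrite mulr_sumr.
  under eq_bigr => b _ do rewrite exchange_big.
  rewrite exchange_big big1 //= => y _.
  rewrite -[RHS](mulr0 (S a c x y)) -[in RHS](IH y (lmul x h)).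
    rewrite mulr_sumr; apply: eq_bigr => b _; rewrite mulr_sumr; apply: eq_bigr => b' _.
    by rewrite mulrCA.
  by move=> v'; exact: (annihilates_catl [:: x] (Kh v')).
have [t tK tE] := pairing3_antisym23 a (fun x y z => rmul S z (lmul y (lmul x h)) u2 v)
  S_braid (proj1 (K_antisym r) Kr).
rewrite tE {tE} /pairing3.
under eq_bigr do rewrite exchange_big.
rewrite exchange_big big1 //= => z _.
rewrite -[LHS](rmul_sum2 S z u2 v (fun x y => t x y z) (fun x y => lmul y (lmul x h))).
rewrite -[RHS](rmul0 S z u2 v); congr (rmul S z _ u2 v).
by apply: funext2 => u v'; exact: (Kh v' [::] u _ (proj2 (K_antisym _) (tK z))).
Qed.

(** The two letters of [r] cross [u] together; at each letter of [u] the braid relation leaves them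
    antisymmetric, and they finally enter the right argument of [h] as a relation. *)
Lemma antisym_rmul2 r h u v : K r -> (forall u, annihilates K (h u)) ->
  \sum_a \sum_b r a b * rmul S b (rmul S a h) u v = 0.
Proof.
elim: u r h => [|c u IH] r h Kr Kh; first exact: (Kh [::] [::] v r Kr).
have [t tK tE] := pairing3_antisym12 c (fun y z w => rmul S w (rmul S z (lmul y h)) u v)
  S_braid (proj1 (K_antisym r) Kr).
transitivity (pairing3 t (fun y z w => rmul S w (rmul S z (lmul y h)) u v)).
  rewrite -tE; apply: eq_bigr => a _; apply: eq_bigr => b _ /=; congr (_ * _).
  apply: eq_bigr => x _; apply: eq_bigr => w _; congr (_ * _).
  exact: (rmul_sum2 S w u v (S a x) (fun y z => rmul S z (lmul y h))).
rewrite /pairing3 big1 // => y _; apply: IH; first exact/K_antisym/tK.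
by move=> u'; exact: Kh.
Qed.

Lemma biannihilates_lmul a h : biannihilates K h -> biannihilates K (lmul a h).
Proof.
move=> [Kh1 Kh2]; split=> [v|u]; last exact: Kh2.
exact: (annihilates_catl [:: a] (Kh1 v)).
Qed.

Lemma annihilates_rmul_r a h : (forall u, annihilates K (h u)) ->
  forall u, annihilates K (rmul S a h u).
Proof.
move=> Kh u; elim: u a h Kh => [|b u IH] a h Kh.
  exact: (annihilates_catl [:: a] (Kh [::])).
have -> : rmul S a h (b :: u) =
    fun w => \sum_(p : 'I_d * 'I_d) S a b p.1 p.2 * rmul S p.2 (lmul p.1 h) u w.
  by apply: functional_extensionality => w; rewrite /= pair_bigA.
by apply: annihilates_sum => p; apply: IH => u'; exact: Kh.
Qed.

Lemma biannihilates_rmul a h : biannihilates K h -> biannihilates K (rmul S a h).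
Proof.
move=> [Kh1 Kh2]; split; first exact: annihilates_rmul_l.
exact: annihilates_rmul_r.
Qed.

Lemma biannihilates_add g h : biannihilates K g -> biannihilates K h ->
  biannihilates K (fun u v => g u v + h u v).
Proof.
have Kadd f f' : annihilates K f -> annihilates K f' -> annihilates K (fun w => f w + f' w).
  move=> Kf Kf' u v r Kr; rewrite -[RHS]addr0.
  rewrite -[X in _ = X + _](Kf u v r Kr) -[X in _ = _ + X](Kf' u v r Kr) -big_split.
  apply: eq_bigr => a _; rewrite -big_split; apply: eq_bigr => b _.
  by rewrite mulrDr.
by move=> [Kg1 Kg2] [Kh1 Kh2]; split=> w; apply: Kadd.
Qed.

(* Letters being primitive, the coproduct of [r] has mixed part [r + S r], which
   vanishes for antisymmetric [r]. *)
Lemma annihilates_comul h : biannihilates K h -> annihilates K (comul S h).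
Proof.
move=> Kh u v r Kr; elim: u h Kh => [|c u IH] h Kh /=; last first.
  apply: IH; apply: biannihilates_add; first exact: biannihilates_lmul.
  exact: biannihilates_rmul.
transitivity (comul S (fun u v => \sum_(p : 'I_d * 'I_d) r p.1 p.2 *
   (h [:: p.1, p.2 & u] v + rmul S p.1 h (p.2 :: u) v +
    (rmul S p.2 (lmul p.1 h) u v + rmul S p.2 (rmul S p.1 h) u v))) v).
  rewrite comul_sum pair_bigA; apply: eq_bigr => p _; congr (_ * comul S _ v).
  by apply: funext2 => u' v'; rewrite rmulD.
suff -> : (fun u v => \sum_(p : 'I_d * 'I_d) r p.1 p.2 *
   (h [:: p.1, p.2 & u] v + rmul S p.1 h (p.2 :: u) v +
    (rmul S p.2 (lmul p.1 h) u v + rmul S p.2 (rmul S p.1 h) u v))) = fun _ _ => 0.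
  exact: comul0.
(* Of the four terms, r # 1 and 1 # r vanish because [h] annihilates the relations in each leg; the
   two mixed terms cancel each other. *)
apply: funext2 => u' v'; have [Kh1 Kh2] := Kh.
under eq_bigr do rewrite !mulrDr.
rewrite !big_split /=.
rewrite -(pair_bigA _ (fun a b => r a b * h [:: a, b & u'] v')) /=.
rewrite (Kh1 v' [::] u' r Kr) add0r.
rewrite -(pair_bigA _ (fun a b => r a b * rmul S b (rmul S a h) u' v')) /=.
rewrite antisym_rmul2 // addr0.
rewrite -(pair_bigA _ (fun a b => r a b * rmul S a h (b :: u') v')) /=.
rewrite -(pair_bigA _ (fun a b => r a b * rmul S b (lmul a h) u' v')) /=.
rewrite -(applyR_dual S r (fun x y => rmul S y (lmul x h) u' v')) -big_split.
rewrite big1 // => a _; rewrite -big_split big1 //= => b _.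
by rewrite (proj1 (K_antisym r) Kr a b) mulNr addNr.
Qed.

(** A relation in the first word crosses as in [antisym_rmul2]; one in the second word survives each
    [rmul]. *)
Lemma biannihilates_cross F : biannihilates K F -> biannihilates K (cross S F).
Proof.
move=> KF; split=> [u w1 w2 r Kr | w].
  elim: w1 F KF => [|c w1 IH] F KF /=; last by apply: IH; exact: biannihilates_rmul.
  have H (x : 'I_d -> 'I_d -> k) : \sum_a \sum_b r a b * x a b =
    \sum_(p : 'I_d * 'I_d) r p.1 p.2 * x p.1 p.2 by rewrite pair_bigA.
  rewrite H -cross_sum.
  have -> : (fun u v => \sum_(p : 'I_d * 'I_d) r p.1 p.2 * rmul S p.2 (rmul S p.1 F) u v)
      = fun _ _ => 0.
    apply: funext2 => u' v'; rewrite -(H (fun a b => rmul S b (rmul S a F) u' v')).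
    by rewrite antisym_rmul2 //; case: KF.
  exact: cross0.
elim: w F KF => [|c w IH] F KF /=; first by case: KF.
by apply: IH; exact: biannihilates_rmul.
Qed.

End Stability.

(** * Evaluation functionals and degree supports *)

(** [E] plays the role of evaluation at a tensor x. Keeping it abstract allows precomposition with
    operations on forms, which amounts to multiplying x by a letter. *)
Definition linear_form (E : (word -> k) -> k) : Prop :=
  forall (I : finType) (c : I -> k) (f : I -> word -> k),
    E (fun w => \sum_i c i * f i w) = \sum_i c i * E (f i).

(** This expresses that x is homogeneous of degree t. *)
Definition degree_form (t : nat) (E : (word -> k) -> k) : Prop :=
  forall f, (forall w, size w = t -> f w = 0) -> E f = 0.

Lemma linear_formD E f g : linear_form E -> E (fun w => f w + g w) = E f + E g.
Proof.
move=> linE.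
have sumE (F : bool -> k) : \sum_b 1 * F b = F true + F false by rewrite big_bool !mul1r.
rewrite -[RHS](sumE (fun b => E (if b then f else g))) -linE.
by congr E; apply: functional_extensionality => w; rewrite sumE.
Qed.

Lemma linear_formZ E a f : linear_form E -> E (fun w => a * f w) = a * E f.
Proof.
move=> linE; have := linE unit (fun=> a) (fun=> f).
rewrite [RHS](big_pred1 tt) => [<-|[] //]; congr E.
by apply: functional_extensionality => w; rewrite (big_pred1 tt) // => -[].
Qed.

Lemma degree_form_ext t E f g : linear_form E -> degree_form t E ->
  (forall w, size w = t -> f w = g w) -> E f = E g.
Proof.
move=> linE degE fg.
have -> : f = fun w => g w + (f w - g w).
  by apply: functional_extensionality => w; rewrite addrCA subrr addr0.
by rewrite linear_formD // [X in _ + X]degE ?addr0 // => w /fg ->; rewrite subrr.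
Qed.

Lemma comulD S g h w :
  comul S (fun u v => g u v + h u v) w = comul S g w + comul S h w.
Proof.
have sumE (f : bool -> k) : \sum_b 1 * f b = f true + f false by rewrite big_bool !mul1r.
rewrite -[RHS](sumE (fun b => comul S (if b then g else h) w)) -comul_sum.
by congr (comul S _ w); apply: funext2 => ? ?; rewrite sumE.
Qed.

Lemma rmul_small S n a h u v :
  (forall u v, (size u + size v < n.+1)%N -> h u v = 0) ->
  (size u + size v < n)%N -> rmul S a h u v = 0.
Proof.
elim: u n a h => [|b u IH] n a h h0 /= uvn; first by apply: h0.
apply: big1 => x _; apply: big1 => y _; case: n => // n in h0 uvn *.
by rewrite (IH n) ?mulr0 // => u' v' uv'; apply: h0.
Qed.

Lemma comul_small S n h w : (forall u v, (size u + size v < n)%N -> h u v = 0) ->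
  (size w < n)%N -> comul S h w = 0.
Proof.
elim: w n h => [|a w IH] [|n] h h0 //= wn; first exact: h0.
apply: (IH n) => // u v uvn; rewrite /lmul h0 ?add0r //.
exact: rmul_small uvn.
Qed.

Lemma rmul_support S n a h : (forall u v, size u != n -> h u v = 0) ->
  forall u v, size u != n -> rmul S a h u v = 0.
Proof.
move=> h0 u v; elim: u n a h h0 => [|b u IH] n a h h0 /= un; first exact: h0.
apply: big1 => x _; apply: big1 => y _; case: n => [|n] in h0 un *.
  suff -> : lmul x h = fun _ _ => 0 by rewrite rmul0 mulr0.
  by apply: funext2 => ? ?; exact: h0.
by rewrite (IH n) ?mulr0 // => u' v' un'; apply: h0.
Qed.

Lemma cross_support S n F : (forall w u, size w != n -> F w u = 0) ->
  forall u w, size w != n -> cross S F u w = 0.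
Proof.
move=> F0 u w wn; elim: u F F0 => [|a u IH] F F0 /=; first exact: F0.
by apply: IH => w' u' w'n; exact: (@rmul_support S n a F F0).
Qed.

Lemma cross_nil S F w : cross S F w [::] = F [::] w.
Proof. by elim: w F => [//|a w IH] F /=; rewrite IH. Qed.

(** Counit property: the component of the coproduct of w whose right leg has degree 0 is w # 1. *)
Lemma comul_nil S h w : (forall u v, v != [::] -> h u v = 0) -> comul S h w = h w [::].
Proof.
elim: w h => [//|a w IH] h h0 /=.
have mul_h0 u v : rmul S a h u v = 0.
  elim: u a h h0 => [|b u IHu] a' h' h0' /=; first exact: h0'.
  by apply: big1 => x _; apply: big1 => y _; rewrite IHu ?mulr0 // => ? ? /h0'; apply.
by rewrite IH => [|u v /h0 hv]; rewrite /lmul mul_h0 addr0 //; exact: hv.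
Qed.

(** * Nondegeneracy for an invertible braiding *)

Section Core.
Variables (S S' : 'I_d -> 'I_d -> 'I_d -> 'I_d -> k) (K : tensor2 -> Prop).
Hypotheses (S_braid : braiding S) (K_antisym : forall r, K r <-> antisym S r).
Hypotheses (S'_braid : braiding S') (K_antisym' : forall r, K r <-> antisym S' r).
Hypothesis SK : forall a b c e,
  \sum_x \sum_y S a b x y * S' x y c e = ((a == c) && (b == e))%:R.

(** The letter that [S] carries across the left word is carried back by the inverse [S'], so it ends
    up in front of the first argument of [F]. *)
Lemma rmul_crossing a F : rmul S a (cross S' F) = cross S' (lmul a F).
Proof.
apply: funext2 => u v; elim: u a F => [//|b u IH] a F /=.
transitivity (\sum_x \sum_y S a b x y * \sum_z \sum_w S' x y z w *
    cross S' (rmul S' w (lmul z F)) u v).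
  apply: eq_bigr => x _; apply: eq_bigr => y _; congr (_ * _).
  have -> : lmul x (cross S' F) = cross S' (rmul S' x F) by [].
  rewrite IH pair_bigA -cross_sum; congr (cross S' _ u v).
  by apply: funext2 => u' v'; rewrite /lmul /= pair_bigA.
rewrite -(applyR_dual S' (S a b) (fun z w => cross S' (rmul S' w (lmul z F)) u v)) /=.
have SKE z w : applyR S' (S a b) z w = ((a == z) && (b == w))%:R by exact: SK.
rewrite (bigD1 a) //= [X in _ + X]big1 => [|z nza]; last first.
  by apply: big1 => w _; rewrite SKE eq_sym (negPf nza) mul0r.
rewrite addr0 (bigD1 b) //= SKE !eqxx mul1r big1 ?addr0 // => w nwb.
by rewrite SKE [b == w]eq_sym (negPf nwb) andbF mul0r.
Qed.

(** Forms obtained by m multiplications on the right leg from forms supported in right degree at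
    least n. Linear combinations are built in because [lmul] of one [rmul] is a sum of several. *)
Inductive rmul_span (n : nat) : nat -> (word -> word -> k) -> Prop :=
| rmul_span_base h : biannihilates K h -> (forall u v, (size v < n)%N -> h u v = 0) ->
    rmul_span n 0 h
| rmul_span_mul m a h : rmul_span n m h -> rmul_span n m.+1 (rmul S a h)
| rmul_span_sum m (I : finType) (c : I -> k) H : (forall i, rmul_span n m (H i)) ->
    rmul_span n m (fun u v => \sum_i c i * H i u v).

Lemma rmul_span_lmul n m a g : rmul_span n m g -> rmul_span n m (lmul a g).
Proof.
move=> span; elim: span a => {m g} [h Kh h0|m a h _ IH|m I c H _ IH] b.
- by apply: rmul_span_base => [|u v]; [exact: biannihilates_lmul | exact: h0].
- have -> : lmul b (rmul S a h) = fun u v =>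
      \sum_(p : 'I_d * 'I_d) S a b p.1 p.2 * rmul S p.2 (lmul p.1 h) u v.
    by apply: funext2 => u v; rewrite /lmul /= pair_bigA.
  by apply: rmul_span_sum => p; apply: rmul_span_mul.
- exact: (rmul_span_sum c (fun i => IH i b)).
Qed.

(* [(1 # v) Delta x = Delta (v x) - (v # 1) Delta x] trades a factor acting on the
   right leg of the coproduct for one multiplied into [x]. *)
Lemma rmul_span_comul n m g t E : rmul_span n m g -> linear_form E -> degree_form t E ->
  (forall f y, annihilates K f -> (n - t <= size y)%N -> E (fun w => f (y ++ w)) = 0) ->
  E (comul S g) = 0.
Proof.
elim: m g t E => [|m' IHm] g t E.
  move Em: 0%N => m0 span; elim: span t E Em => {m0 g}
    [h Kh h0|//|m I c H _ IH] t E m0 linE degE KE.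
    (* If n <= t, the hypothesis on [E] applies with empty [y]; if t < n, a coproduct of total
       degree t has no component of right degree n or more. *)
    case: (leqP n t) => [nt|tn].
      apply: (KE (comul S h) [::]); first exact: annihilates_comul.
      by rewrite leqn0 subn_eq0.
    apply: degE => w wt; apply: (@comul_small _ n); last by rewrite wt.
    by move=> u v uvn; apply: h0; apply: leq_ltn_trans uvn; exact: leq_addl.
  have -> : comul S (fun u v => \sum_i c i * H i u v) = fun w => \sum_i c i * comul S (H i) w.
    by apply: functional_extensionality => w; rewrite comul_sum.
  by rewrite linE big1 // => i _; rewrite (IH i t) ?mulr0.
move Em: m'.+1 => m span; elim: span t E Em => {m g}
  [//|m a h span _|m I c H _ IH] t E Em linE degE KE; last first.
  have -> : comul S (fun u v => \sum_i c i * H i u v) = fun w => \sum_i c i * comul S (H i) w.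
    by apply: functional_extensionality => w; rewrite comul_sum.
  by rewrite linE big1 // => i _; rewrite (IH i t) ?mulr0.
(* The product [a x] is handled in degree t + 1 by precomposing [E] with the prefix [a]; the [lmul]
   term stays in degree t. Both use one factor fewer. *)
case: Em span => <- span; have := IHm h t.+1 (fun f => E (fun w => f (a :: w))) span.
have -> : (fun w => comul S h (a :: w)) = fun w => comul S (lmul a h) w + comul S (rmul S a h) w.
  by apply: functional_extensionality => w; rewrite -comulD.
rewrite linear_formD // (IHm (lmul a h) t E (rmul_span_lmul a span)) // add0r; apply.
- by move=> I c f; rewrite linE.
- by move=> f f0; apply: degE => w wt; apply: f0; rewrite /= wt.
move=> f y Kf ny.
have := KE f (rcons y a) Kf; rewrite size_rcons.
under [X in E X = 0]functional_extensionality do rewrite cat_rcons.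
apply; lia.
Qed.

(* Apply [rmul_span_comul] to [h = (psi # f) o braiding^-1], which annihilates both ideals
   because the inverse braiding [S'] has the same antisymmetric tensors. *)
Lemma nondegenerate_left n psi y0 t E : annihilates K psi ->
  (forall w, size w != n -> psi w = 0) -> size y0 = n -> psi y0 != 0 ->
  linear_form E -> degree_form t E ->
  (forall f y, annihilates K f -> (n - t <= size y)%N -> E (fun w => f (y ++ w)) = 0) ->
  forall f, annihilates K f -> E f = 0.
Proof.
move=> Kpsi psi0 y0n psi_y0 linE degE KE f Kf.
pose F y w u := psi (y ++ w) * f u.
(* The last letter of [y] is a left multiplication on [F], which [rmul_crossing] converts into one
   more [rmul]. *)
have span y : rmul_span n (size y) (cross S' (F y)).
  elim/last_ind: y => [|y a IH].
    apply: rmul_span_base => [|u v vn].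
      apply: biannihilates_cross => //; split=> [u|w] u1 u2 r Kr.
        under eq_bigr do under eq_bigr do rewrite /F mulrA.
        under eq_bigr do rewrite -mulr_suml.
        by rewrite -mulr_suml [X in X * _](Kpsi u1 u2 r Kr) mul0r.
      under eq_bigr do under eq_bigr do rewrite /F mulrCA.
      under eq_bigr do rewrite -mulr_sumr.
      by rewrite -mulr_sumr [X in _ * X](Kf u1 u2 r Kr) mulr0.
    apply: (@cross_support _ n) => [w u' wn|]; first by rewrite /F psi0 ?mul0r.
    by rewrite neq_ltn vn.
  have -> : F (rcons y a) = lmul a (F y) by apply: funext2 => w u; rewrite /F /lmul cat_rcons.
  by rewrite size_rcons -rmul_crossing; apply: rmul_span_mul.
have := rmul_span_comul (span y0) linE degE => /(_ KE).
(* As [y0] already has degree n and [psi] lives in degree n, [F y0 w u] vanishes for nonempty [w];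
   only the counit component of the coproduct remains. *)
have -> : comul S (cross S' (F y0)) = fun w => psi y0 * f w.
  apply: functional_extensionality => w.
  rewrite comul_nil ?cross_nil /F ?cats0 // => u v; rewrite -size_eq0 => v0.
  apply: (@cross_support _ 0) => // w' u' w'0.
  by rewrite psi0 ?mul0r // size_cat; lia.
by rewrite linear_formZ // => /eqP; rewrite mulf_eq0 (negPf psi_y0) => /eqP.
Qed.

End Core.

Lemma applyRD S (r s : tensor2) :
  applyR S (fun a b => r a b + s a b) = fun a b => applyR S r a b + applyR S s a b.
Proof.
apply: funext2 => a b; rewrite /applyR -big_split; apply: eq_bigr => x _.
by rewrite -big_split; apply: eq_bigr => y _; rewrite mulrDl.
Qed.

Lemma applyRZ S c (r : tensor2) :
  applyR S (fun a b => c * r a b) = fun a b => c * applyR S r a b.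
Proof.
apply: funext2 => a b; rewrite /applyR mulr_sumr; apply: eq_bigr => x _.
by rewrite mulr_sumr; apply: eq_bigr => y _; rewrite mulrA.
Qed.

Lemma applyR_delta (S : 'I_d -> 'I_d -> 'I_d -> 'I_d -> k) a b :
  applyR S (fun x y => ((a == x) && (b == y))%:R) = S a b.
Proof.
apply: funext2 => x y; rewrite /applyR (bigD1 a) //= (bigD1 b) //= !eqxx mul1r.
rewrite big1 ?addr0 => [|j /negPf nj]; last by rewrite [b == j]eq_sym nj mul0r.
rewrite big1 ?addr0 // => i /negPf ni; apply: big1 => j _.
by rewrite [a == i]eq_sym ni mul0r.
Qed.

(** * The braiding of a Hecke symmetry *)

Section HeckeBraiding.
Variables (Rc : 'I_d -> 'I_d -> 'I_d -> 'I_d -> k) (q : k).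
Hypothesis HR : hecke_symmetry Rc q.

Definition hecke_braiding : 'I_d -> 'I_d -> 'I_d -> 'I_d -> k :=
  fun a b x y => - q^-1 * Rc a b x y.

(** The Hecke relation gives q R^-1 = R - (q - 1), so this is - q R^-1, the inverse of S = - R /
    q. *)
Definition hecke_braiding_inv : 'I_d -> 'I_d -> 'I_d -> 'I_d -> k :=
  fun a b x y => (q - 1) * ((a == x) && (b == y))%:R - Rc a b x y.

Let q0 : q != 0. Proof. by case: HR. Qed.

Lemma apply_hecke_braiding r :
  applyR hecke_braiding r = fun a b => - q^-1 * applyR Rc r a b.
Proof.
apply: funext2 => a b; rewrite /applyR mulr_sumr; apply: eq_bigr => x _.
by rewrite mulr_sumr; apply: eq_bigr => y _; rewrite mulrCA.
Qed.

Lemma apply_hecke_braiding_inv r :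
  applyR hecke_braiding_inv r = fun a b => (q - 1) * r a b - applyR Rc r a b.
Proof.
apply: funext2 => a b; rewrite /applyR /hecke_braiding_inv.
under eq_bigr do under eq_bigr do rewrite mulrBr.
under eq_bigr do rewrite sumrB.
rewrite sumrB; congr (_ - _).
rewrite (bigD1 a) //= (bigD1 b) //= !eqxx mulr1 mulrC.
rewrite big1 ?addr0 => [|j /negPf nj]; last by rewrite nj andbF !mulr0.
rewrite big1 ?addr0 // => i /negPf ni; apply: big1 => j _.
by rewrite ni !mulr0.
Qed.

Lemma hecke_square r a b :
  applyR Rc (applyR Rc r) a b = (q - 1) * applyR Rc r a b + q * r a b.
Proof.
have [_ _ /(_ r a b) /=] := HR; rewrite applyRD => H.
by apply/eqP; rewrite -subr_eq0 -[X in _ == X]H; apply/eqP; ring.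
Qed.

Lemma hecke_braidingK r : applyR hecke_braiding_inv (applyR hecke_braiding r) = r.
Proof.
apply: funext2 => a b; rewrite apply_hecke_braiding_inv apply_hecke_braiding.
by rewrite applyRZ hecke_square; field.
Qed.

Lemma hecke_braiding_invK r : applyR hecke_braiding (applyR hecke_braiding_inv r) = r.
Proof.
apply: funext2 => a b; rewrite apply_hecke_braiding apply_hecke_braiding_inv.
have -> : (fun a b => (q - 1) * r a b - applyR Rc r a b) =
    fun a b => (q - 1) * r a b + (-1) * applyR Rc r a b.
  by apply: funext2 => x y; rewrite mulN1r.
by rewrite applyRD !applyRZ hecke_square; field.
Qed.

Lemma hecke_braiding_inverse a b c e :
  \sum_x \sum_y hecke_braiding a b x y * hecke_braiding_inv x y c e
  = ((a == c) && (b == e))%:R.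
Proof.
have := hecke_braidingK (fun x y => ((a == x) && (b == y))%:R).
by rewrite applyR_delta => /(f_equal (fun f => f c e)).
Qed.

Lemma kerRq_antisym r : kerRq Rc q r <-> antisym hecke_braiding r.
Proof.
rewrite /kerRq /antisym apply_hecke_braiding.
split=> H a b; first by rewrite H mulNr mulKf.
by apply: (mulfI (invr_neq0 q0)); rewrite mulKf // -[LHS]opprK -mulNr H opprK.
Qed.

Lemma kerRq_antisym_inv r : kerRq Rc q r <-> antisym hecke_braiding_inv r.
Proof.
rewrite /kerRq /antisym apply_hecke_braiding_inv.
split=> H a b; first by rewrite H; ring.
have -> : applyR Rc r a b = (q - 1) * r a b - ((q - 1) * r a b - applyR Rc r a b) by ring.
by rewrite H; ring.
Qed.

Lemma hecke_braiding_braid : braiding hecke_braiding.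
Proof.
have S12 t : R12 hecke_braiding t = fun x y z => - q^-1 * R12 Rc t x y z.
  apply: funext3 => x y z.
  exact: (f_equal (fun f => f x y) (apply_hecke_braiding (fun x y => t x y z))).
have S23 t : R23 hecke_braiding t = fun x y z => - q^-1 * R23 Rc t x y z.
  apply: funext3 => x y z.
  exact: (f_equal (fun f => f y z) (apply_hecke_braiding (t x))).
have Z12 c (t : tensor3) : R12 Rc (fun x y z => c * t x y z) = fun x y z => c * R12 Rc t x y z.
  apply: funext3 => x y z.
  exact: (f_equal (fun f => f x y) (applyRZ Rc c (fun x y => t x y z))).
have Z23 c (t : tensor3) : R23 Rc (fun x y z => c * t x y z) = fun x y z => c * R23 Rc t x y z.
  by apply: funext3 => x y z; exact: (f_equal (fun f => f y z) (applyRZ Rc c (t x))).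
move=> t x y z; rewrite S12 S23 S12 !(Z12, Z23) S23 S12 S23 !(Z12, Z23).
by have [_ -> _] := HR.
Qed.

Lemma hecke_braiding_inv_braid : braiding hecke_braiding_inv.
Proof.
pose P1 := R12 hecke_braiding; pose P2 := R23 hecke_braiding.
pose Q1 := R12 hecke_braiding_inv; pose Q2 := R23 hecke_braiding_inv.
have QP1 t : Q1 (P1 t) = t.
  apply: funext3 => x y z.
  exact: (f_equal (fun f => f x y) (hecke_braidingK (fun x y => t x y z))).
have PQ1 t : P1 (Q1 t) = t.
  apply: funext3 => x y z.
  exact: (f_equal (fun f => f x y) (hecke_braiding_invK (fun x y => t x y z))).
have QP2 t : Q2 (P2 t) = t.
  by apply: funext3 => x y z; exact: (f_equal (fun f => f y z) (hecke_braidingK (t x))).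
have PQ2 t : P2 (Q2 t) = t.
  by apply: funext3 => x y z; exact: (f_equal (fun f => f y z) (hecke_braiding_invK (t x))).
have braidP t : P1 (P2 (P1 t)) = P2 (P1 (P2 t)).
  by apply: funext3; exact: hecke_braiding_braid.
move=> t x y z; rewrite -/Q1 -/Q2.
(* Write t as P2 P1 P2 applied to Q2 Q1 Q2 t, replace P2 P1 P2 by P1 P2 P1, and cancel against Q1 Q2
   Q1. *)
rewrite -[t in LHS]PQ2 -[Q2 t in LHS]PQ1 -[Q1 (Q2 t) in LHS]PQ2.
by rewrite -braidP QP1 QP2 QP1.
Qed.

Lemma hecke_nondegenerate_left n psi y0 t E : annihilates (kerRq Rc q) psi ->
  (forall w, size w != n -> psi w = 0) -> size y0 = n -> psi y0 != 0 ->
  linear_form E -> degree_form t E ->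
  (forall f y, annihilates (kerRq Rc q) f -> (n - t <= size y)%N ->
     E (fun w => f (y ++ w)) = 0) ->
  forall f, annihilates (kerRq Rc q) f -> E f = 0.
Proof.
exact: (nondegenerate_left hecke_braiding_braid kerRq_antisym
  hecke_braiding_inv_braid kerRq_antisym_inv hecke_braiding_inverse).
Qed.

End HeckeBraiding.

(** * Reversal of words and the right-hand version *)

(** Conjugation of R by the flip: reversing words matches its relations with those of R and
    exchanges left and right multiplication. *)
Definition mirror (Rc : 'I_d -> 'I_d -> 'I_d -> 'I_d -> k) : 'I_d -> 'I_d -> 'I_d -> 'I_d -> k :=
  fun i j a b => Rc j i b a.

Lemma applyR_mirror Rc (r : tensor2) :
  applyR (mirror Rc) r = fun a b => applyR Rc (fun x y => r y x) b a.
Proof. by apply: funext2 => a b; rewrite /applyR exchange_big. Qed.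

Lemma hecke_mirror Rc q : hecke_symmetry Rc q -> hecke_symmetry (mirror Rc) q.
Proof.
case=> q0 yb sq; split=> // [t x y z|r a b /=].
  have M12 s : R12 (mirror Rc) s = fun x y z => R23 Rc (fun x y z => s z y x) z y x.
    by apply: funext3 => *; rewrite /R12 exchange_big.
  have M23 s : R23 (mirror Rc) s = fun x y z => R12 Rc (fun x y z => s z y x) z y x.
    by apply: funext3 => *; rewrite /R23 exchange_big.
  by rewrite M12 M23 M12 M23 M12 M23 yb.
have := sq (fun x y => r y x) b a; rewrite /= !applyRD.
by rewrite !(applyR_mirror Rc).
Qed.

Lemma annihilates_mirror Rc q f : annihilates (kerRq Rc q) f ->
  annihilates (kerRq (mirror Rc) q) (fun w => f (rev w)).
Proof.
move=> Kf u v r Kr; rewrite -[RHS](Kf (rev v) (rev u) (fun x y => r y x)).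
  rewrite exchange_big; apply: eq_bigr => b _; apply: eq_bigr => a _.
  by rewrite rev_cat !rev_cons -!cats1 -!catA.
by move=> a b; have := Kr b a; rewrite applyR_mirror.
Qed.

Lemma hecke_nondegenerate_right Rc q n psi y0 t E : hecke_symmetry Rc q ->
  annihilates (kerRq Rc q) psi ->
  (forall w, size w != n -> psi w = 0) -> size y0 = n -> psi y0 != 0 ->
  linear_form E -> degree_form t E ->
  (forall f y, annihilates (kerRq Rc q) f -> (n - t <= size y)%N ->
     E (fun w => f (w ++ y)) = 0) ->
  forall f, annihilates (kerRq Rc q) f -> E f = 0.
Proof.
move=> HR Kpsi psi0 y0n psiy0 linE degE KE f Kf.
have revE (g : word -> k) : (fun w => g (rev (rev w))) = g.
  by apply: functional_extensionality => w; rewrite revK.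
rewrite -[f]revE.
refine (@hecke_nondegenerate_left (mirror Rc) q (hecke_mirror HR) n (fun w => psi (rev w))
  (rev y0) t (fun g => E (fun w => g (rev w))) _ _ _ _ _ _ _ (fun w => f (rev w))
  (annihilates_mirror Kf)).
- exact: annihilates_mirror.
- by move=> w wn; rewrite psi0 ?size_rev.
- by rewrite size_rev.
- by rewrite revK.
- by move=> I c g; rewrite linE.
- by move=> g g0; apply: degE => w wt; rewrite g0 ?size_rev.
move=> g y Kg ny; have := KE (fun w => g (rev w)) (rev y) (annihilates_mirror Kg).
rewrite size_rev => /(_ ny) <-; congr E; apply: functional_extensionality => w.
by rewrite rev_cat revK.
Qed.

(** * Duality between the ideal and its annihilator *)

Section Duality.
Variables (I : finType) (U : (I -> k) -> Prop).
Hypothesis U_sum : forall m (c : 'I_m -> k) (f : 'I_m -> I -> k),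
  (forall j, U (f j)) -> U (fun i => \sum_j c j * f j i).

Let vec (f : I -> k) : 'rV[k]_#|I| := \row_j f (enum_val j).

(* Enlarge the matrix by elements of [U] until its rank is maximal. *)
Lemma spanning_matrix : exists m (f : 'I_m -> I -> k), (forall j, U (f j)) /\
  forall g, U g -> (vec g <= \matrix_j vec (f j))%MS.
Proof.
suff ext n m (f : 'I_m -> I -> k) : (forall j, U (f j)) ->
    (#|I| - \rank (\matrix_j vec (f j)) <= n)%N ->
    exists m (f : 'I_m -> I -> k), (forall j, U (f j)) /\
      forall g, U g -> (vec g <= \matrix_j vec (f j))%MS.
  by apply: (ext _ 0%N (fun _ _ => 0) _ (leqnn _)) => -[].
elim: n m f => [|n IH] m f Uf rkf.
  exists m, f; split=> // g _; apply: submx_full.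
  by move: rkf; rewrite leqn0 subn_eq0 /row_full eqn_leq rank_leq_col.
case: (classic (exists2 g, U g & ~~ (vec g <= \matrix_j vec (f j))%MS)) => [[g Ug ng]|no].
  pose f' (j : 'I_m.+1) := if unlift ord0 j is Some i then f i else g.
  apply: (IH m.+1 f') => [j|]; first by rewrite /f'; case: (unlift _ _).
  suff : (\rank (\matrix_j vec (f j)) < \rank (\matrix_j vec (f' j)))%N by lia.
  apply: rank_ltmx; rewrite /ltmx; apply/andP; split.
    apply/row_subP => j; rewrite rowK.
    by have := row_sub (lift ord0 j) (\matrix_j vec (f' j)); rewrite rowK /f' liftK.
  apply: contra ng => sub; apply: submx_trans sub.
  by have := row_sub ord0 (\matrix_j vec (f' j)); rewrite rowK /f' unlift_none.
exists m, f; split=> // g Ug; apply/negPn/negP => ng; apply: no.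
by exists g.
Qed.

(** The columns of the cokernel of a spanning matrix are forms vanishing on [U]; a vector outside
    the row space has a nonzero product with one of them. *)
Lemma separating_functional x : ~ U x ->
  exists2 c : I -> k, (forall f, U f -> \sum_i c i * f i = 0) & \sum_i c i * x i != 0.
Proof.
move=> nUx; have [m [f [Uf spanf]]] := spanning_matrix.
pose A := \matrix_j vec (f j).
have pairE (g : I -> k) j :
    \sum_i cokermx A (enum_rank i) j * g i = (vec g *m cokermx A) 0 j.
  rewrite mxE (reindex_onto enum_val enum_rank) => [|i _]; last exact: enum_rankK.
  under eq_bigl do rewrite enum_valK eqxx.
  by apply: eq_bigr => i _; rewrite enum_valK mulrC [vec g _ _]mxE.
have : vec x *m cokermx A != 0.
  apply/negP => /eqP x0; apply: nUx.
  have /submxP[D xD] : (vec x <= A)%MS by rewrite submxE x0.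
  have := U_sum (fun j => D 0 j) Uf; congr U; apply: functional_extensionality => i.
  have := f_equal (fun B : 'rV_#|I| => B 0 (enum_rank i)) xD.
  rewrite /vec !mxE enum_rankK => ->.
  by apply: eq_bigr => j _; rewrite !mxE enum_rankK.
move=> /rV0Pn[j nz]; exists (fun i => cokermx A (enum_rank i) j) => [g Ug|]; rewrite pairE //.
by have := spanf g Ug; rewrite submxE => /eqP ->; rewrite mxE.
Qed.

End Duality.

(** * Truncation to words of bounded length *)

Definition short_word (N : nat) : finType := {i : 'I_N.+1 & i.-tuple 'I_d}.
Definition word_of N (t : short_word N) : word := tagged t.

Lemma phiN_short_word N (c f : word -> k) :
  phiN c N f = \sum_(t : short_word N) c (word_of t) * f (word_of t).
Proof. by rewrite /phiN sig_big_dep. Qed.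

Lemma sum_tuple_eq n (w : word) (G : word -> k) :
  \sum_(t : n.-tuple 'I_d) (w == t :> word)%:R * G t = (size w == n)%:R * G w.
Proof.
case: eqP => [wn|nwn]; last first.
  rewrite mul0r big1 // => t _; case: eqP => [wt|]; last by rewrite mul0r.
  by case: nwn; rewrite wt size_tuple.
rewrite (bigD1 (Tuple (introT eqP wn))) //= eqxx big1 ?addr0 // => t nt.
case: eqP => [wt|]; last by rewrite mul0r.
by rewrite -val_eqE /= wt eqxx in nt.
Qed.

Lemma phiN_delta N w (G : word -> k) :
  phiN (fun t => (w == t)%:R) N G = (size w <= N)%:R * G w.
Proof.
rewrite /phiN; under eq_bigr do rewrite sum_tuple_eq.
case: leqP => [wN|Nw].
  rewrite (bigD1 (Ordinal (wN : (size w < N.+1)%N))) //= eqxx big1 ?addr0 // => i ni.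
  by rewrite eq_sym -val_eqE /= in ni; rewrite (negPf ni) mul0r.
rewrite mul0r big1 // => i _; case: eqP => [wi|]; last by rewrite mul0r.
by have := ltn_ord i; rewrite -wi ltnS leqNgt Nw.
Qed.

(** * Membership in the ideal *)

Section Ideal.
Variables (Rc : 'I_d -> 'I_d -> 'I_d -> 'I_d -> k) (q : k).

Lemma in_ideal0 : in_ideal Rc q (fun _ => 0).
Proof. by exists [::]; split=> [t []|w]; rewrite big_nil. Qed.

Lemma in_idealD f g : in_ideal Rc q f -> in_ideal Rc q g -> in_ideal Rc q (fun w => f w + g w).
Proof.
move=> [s [Ks fs]] [s' [Ks' gs']]; exists (s ++ s'); split=> [t|w].
  by move=> /(@List.in_app_or _ _ _ _) [/Ks|/Ks'].
by rewrite fs gs' big_cat.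
Qed.

Lemma in_idealZ c f : in_ideal Rc q f -> in_ideal Rc q (fun w => c * f w).
Proof.
move=> [s [Ks fs]]; exists [seq (t.1.1, fun a b => c * t.1.2 a b, t.2) | t <- s].
split=> [t|w].
  move=> /(proj1 (List.in_map_iff _ _ _)) [t' [<- /Ks Kt']] a b /=.
  by rewrite applyRZ Kt' mulrCA.
rewrite fs big_map mulr_sumr; apply: eq_bigr => t _; rewrite /sandwich mulr_sumr.
by apply: eq_bigr => a _; rewrite mulr_sumr; apply: eq_bigr => b _; rewrite mulrA.
Qed.

Lemma in_ideal_sum (I : finType) (c : I -> k) (f : I -> word -> k) :
  (forall i, in_ideal Rc q (f i)) -> in_ideal Rc q (fun w => \sum_i c i * f i w).
Proof.
move=> If; elim: (index_enum I) => [|i s IH].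
  by have := in_ideal0; congr in_ideal; apply: functional_extensionality => w; rewrite big_nil.
have := in_idealD (in_idealZ (c i) (If i)) IH.
by congr in_ideal; apply: functional_extensionality => w; rewrite big_cons.
Qed.

Lemma sandwich_in_ideal u r v : kerRq Rc q r -> in_ideal Rc q (sandwich u r v).
Proof.
move=> Kr; exists [:: (u, r, v)]; split=> [t [<-|[]] //|w].
by rewrite big_seq1.
Qed.

Lemma sum_sandwich (I : finType) (W : I -> word) (c : I -> k) u r v :
  \sum_i c i * sandwich u r v (W i)
  = \sum_a \sum_b r a b * \sum_i (u ++ a :: b :: v == W i)%:R * c i.
Proof.
under eq_bigr do rewrite /sandwich mulr_sumr.
rewrite exchange_big; apply: eq_bigr => a _ /=.
under eq_bigr do rewrite mulr_sumr.
rewrite exchange_big; apply: eq_bigr => b _ /=.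
by rewrite mulr_sumr; apply: eq_bigr => i _; rewrite eq_sym mulrC -!mulrA.
Qed.

(** Each generator of the ideal is homogeneous, so truncation at degree N keeps it whole or drops it
    whole. *)
Lemma phiN_in_ideal N c f : annihilates (kerRq Rc q) c -> in_ideal Rc q f -> phiN c N f = 0.
Proof.
move=> Kc [s [Ks fs]]; rewrite phiN_short_word.
under eq_bigr do rewrite fs mulr_sumr.
rewrite exchange_big /=; elim: s Ks {fs} => [|t s IH] Ks; first by rewrite big_nil.
rewrite big_cons IH ?addr0 => [|t' t's]; last by apply: Ks; right.
rewrite sum_sandwich.
under eq_bigr do under eq_bigr do rewrite -(phiN_short_word _ (fun w => (_ == w)%:R)) phiN_delta.
have Kt : kerRq Rc q t.1.2 by apply: Ks; left.
have sz a b : size (t.1.1 ++ a :: b :: t.2) = (size t.1.1 + (size t.2).+2)%N by rewrite size_cat.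
under eq_bigr do under eq_bigr do rewrite sz mulrCA.
under eq_bigr do rewrite -mulr_sumr.
by rewrite -mulr_sumr Kc ?mulr0.
Qed.

(** Double annihilator: a separating form found on the finite-dimensional space of tensors of degree
    at most N extends by zero to an annihilator of the ideal. *)
Lemma in_ideal_dual N f : bounded f N ->
  (forall c, annihilates (kerRq Rc q) c -> phiN c N f = 0) -> in_ideal Rc q f.
Proof.
move=> fN Kf; apply: NNPP => nIf.
pose ext (g : short_word N -> k) w := \sum_(t : short_word N) (w == word_of t)%:R * g t.
have extE (g : word -> k) w : ext (fun t => g (word_of t)) w = (size w <= N)%:R * g w.
  by rewrite -phiN_delta phiN_short_word.
have [m c g Ig||c0 c0I c0f] := @separating_functional _ (fun g => in_ideal Rc q (ext g)) _
    (fun t => f (word_of t)).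
- have := in_ideal_sum c Ig; congr in_ideal; apply: functional_extensionality => w.
  rewrite /ext; under eq_bigr do rewrite mulr_sumr.
  rewrite exchange_big; apply: eq_bigr => t _ /=; rewrite mulr_sumr.
  by apply: eq_bigr => j _; rewrite mulrCA.
- suff -> : ext (fun t => f (word_of t)) = f by [].
  apply: functional_extensionality => w; rewrite extE.
  by case: leqP => [_|/fN ->]; rewrite ?mul1r ?mulr0.
have := Kf (ext c0); rewrite phiN_short_word.
under eq_bigr do rewrite mulr_suml.
rewrite exchange_big /=.
under eq_bigr => s _.
  under eq_bigr => t _ do rewrite mulrAC eq_sym.
  rewrite -mulr_suml -(phiN_short_word _ (fun w => (word_of s == w)%:R)) phiN_delta.
  rewrite mulrC -ltnS size_tuple ltn_ord mul1r.
over.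
move=> H; case/eqP: c0f; apply: H => u v r Kr.
rewrite -sum_sandwich; apply: c0I.
(* The truncated generator is either the generator itself or 0, hence in the ideal. *)
have -> : ext (fun t => sandwich u r v (word_of t)) =
    fun w => (size u + (size v).+2 <= N)%N%:R * sandwich u r v w.
  apply: functional_extensionality => w; rewrite extE /sandwich !mulr_sumr.
  apply: eq_bigr => a _; rewrite !mulr_sumr; apply: eq_bigr => b _.
  case: eqP => [->|_]; last by rewrite !mulr0.
  by rewrite size_cat.
exact/in_idealZ/sandwich_in_ideal.
Qed.

End Ideal.

(** * The top degree *)

Lemma annihilates_degree K f n : annihilates K f ->
  annihilates K (fun w => (size w == n)%:R * f w).
Proof.
move=> Kf u v r /(Kf u v) Kr.
have sz a b : size (u ++ a :: b :: v) = (size u + (size v).+2)%N by rewrite size_cat.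
under eq_bigr do under eq_bigr do rewrite sz mulrCA.
under eq_bigr do rewrite -mulr_sumr.
by rewrite -mulr_sumr Kr mulr0.
Qed.

(** * Values of a form of degree n on products *)

Lemma phiN_homog n M (psi f : word -> k) : (forall w, size w != n -> psi w = 0) -> (n <= M)%N ->
  phiN psi M f = \sum_(w : n.-tuple 'I_d) psi w * f w.
Proof.
move=> psi0 nM; rewrite /phiN (bigD1 (Ordinal (nM : (n < M.+1)%N))) //= [X in _ + X]big1 ?addr0 //.
move=> i ni; apply: big1 => w _; rewrite psi0 ?mul0r // size_tuple.
by rewrite -val_eqE in ni.
Qed.

Lemma cat_tuple_sum n i (w : n.-tuple 'I_d) (F : word -> word -> k) : (i <= n)%N ->
  \sum_(x : i.-tuple 'I_d) \sum_(y : (n - i).-tuple 'I_d)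
    (x ++ y == w :> word)%:R * F x y = F (take i w) (drop i w).
Proof.
move=> lin; have size_take_w : size (take i w) = i by rewrite size_takel ?size_tuple.
transitivity (\sum_(x : i.-tuple 'I_d) (take i w == x :> word)%:R *
  \sum_(y : (n - i).-tuple 'I_d) (drop i w == y :> word)%:R * F x y).
  apply: eq_bigr => x _; rewrite mulr_sumr; apply: eq_bigr => y _.
  rewrite -{1}[val w](cat_take_drop i) eqseq_cat ?size_take_w ?size_tuple //.
  by rewrite -mulnb natrM -mulrA eq_sym [y == _ :> word]eq_sym.
under eq_bigr do rewrite (sum_tuple_eq _ _ (F _)) size_drop size_tuple eqxx mul1r.
by rewrite (sum_tuple_eq _ _ (F^~ (drop i w))) size_take_w eqxx mul1r.
Qed.

Lemma phiN_tmul n M (psi f g : word -> k) : (forall w, size w != n -> psi w = 0) ->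
  (n <= M)%N ->
  phiN psi M (tmul f g) = \sum_(i < n.+1) \sum_(x : i.-tuple 'I_d)
    \sum_(y : (n - i).-tuple 'I_d) f x * g y * psi (x ++ y).
Proof.
move=> psi0 nM; rewrite (phiN_homog _ psi0 nM) /tmul.
under eq_bigr do rewrite size_tuple mulr_sumr.
rewrite exchange_big; apply: eq_bigr => i _ /=.
have lin : (i <= n)%N by rewrite -ltnS.
under eq_bigr do rewrite -(cat_tuple_sum _ (fun x y => f x * g y) lin) mulr_sumr.
rewrite exchange_big; apply: eq_bigr => x _ /=.
under eq_bigr do rewrite mulr_sumr.
rewrite exchange_big; apply: eq_bigr => y _ /=.
have := sum_tuple_eq n (x ++ y) (fun w => f x * g y * psi w).
rewrite size_cat !size_tuple subnKC // eqxx mul1r => <-.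
by apply: eq_bigr => w _; rewrite mulrCA [psi w * _]mulrC.
Qed.

Definition word_delta (w : word) : word -> k := fun v => (v == w)%:R.

(** Multiplying by a basis word of degree n - t isolates the degree t component of [f]. *)
Lemma phiN_tmul_deltar n M (psi f : word -> k) t y : (forall w, size w != n -> psi w = 0) ->
  (n <= M)%N -> (t <= n)%N -> size y = (n - t)%N ->
  phiN psi M (tmul f (word_delta y)) = \sum_(x : t.-tuple 'I_d) f x * psi (x ++ y).
Proof.
move=> psi0 nM tn yt; rewrite (phiN_tmul _ _ psi0 nM).
rewrite (bigD1 (Ordinal (tn : (t < n.+1)%N))) //= [X in _ + X]big1 ?addr0 => [|i nit].
  apply: eq_bigr => x _; rewrite /word_delta.
  under eq_bigr do rewrite eq_sym mulrAC mulrC.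
  by rewrite (sum_tuple_eq _ _ (fun v => f x * psi (x ++ v))) yt eqxx mul1r.
apply: big1 => x _; apply: big1 => v _; rewrite /word_delta.
case: eqP => [vy|]; last by rewrite mulr0 mul0r.
move: nit; rewrite -val_eqE /= => /eqP; case.
have := size_tuple v; rewrite vy yt; have := ltn_ord i; lia.
Qed.

Lemma phiN_tmul_deltal n M (psi f : word -> k) t y : (forall w, size w != n -> psi w = 0) ->
  (n <= M)%N -> (t <= n)%N -> size y = (n - t)%N ->
  phiN psi M (tmul (word_delta y) f) = \sum_(x : t.-tuple 'I_d) f x * psi (y ++ x).
Proof.
move=> psi0 nM tn yt; rewrite (phiN_tmul _ _ psi0 nM).
have nt : (n - t < n.+1)%N by rewrite ltnS leq_subr.
rewrite (bigD1 (Ordinal nt)) //= [X in _ + X]big1 ?addr0 => [|i nit].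
  rewrite subKn // exchange_big; apply: eq_bigr => x _; rewrite /word_delta.
  under eq_bigr do rewrite eq_sym -mulrA.
  by rewrite (sum_tuple_eq _ _ (fun v => f x * psi (v ++ x))) yt eqxx mul1r.
apply: big1 => v _; apply: big1 => x _; rewrite /word_delta.
case: eqP => [vy|]; last by rewrite !mul0r.
by move: nit; rewrite -val_eqE /= -yt -vy size_tuple eqxx.
Qed.

(** * The one-dimensional component and its pairing *)

Section Top.
Variables (Rc : 'I_d -> 'I_d -> 'I_d -> 'I_d -> k) (q : k) (n : nat).
Hypothesis HR : hecke_symmetry Rc q.
Notation Ann := (annihilates (kerRq Rc q)).

(** The dual of the one-dimensional Lambda_n is a line; [psi] is its generator normalized at a word
    [y0] where it does not vanish. *)
Lemma top_functional : Lambda_dim1 Rc q n -> exists psi y0,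
  [/\ Ann psi, forall w, size w != n -> psi w = 0, size y0 = n, psi y0 = 1 &
    forall f, Ann f -> forall w, size w = n -> f w = f y0 * psi w].
Proof.
case=> e [he nIe He].
have ebd : bounded e n by move=> w nw; apply: he; rewrite gtn_eqF.
have [c Kc ce] : exists2 c, Ann c & phiN c n e != 0.
  apply: NNPP => no; apply: nIe; apply: (in_ideal_dual ebd) => c Kc.
  by apply/eqP/negPn/negP => ce; apply: no; exists c.
have phi_e f : phiN f n e = \sum_(w : n.-tuple 'I_d) f w * e w.
  under [RHS]eq_bigr do rewrite mulrC.
  rewrite -(phiN_homog _ he (leqnn n)) !phiN_short_word.
  by apply: eq_bigr => t _; rewrite mulrC.
have [y0 cy0] : exists y0 : n.-tuple 'I_d, c y0 != 0.
  apply/existsP; apply: contraNT ce => /existsPn c0.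
  by rewrite phi_e big1 // => w _; move/negPn/eqP: (c0 w) => ->; rewrite mul0r.
(* Modulo the ideal w equals a e, so f and c take at w the values a f(e) and a c(e); eliminating a
   gives the identity. *)
have prop f w : Ann f -> size w = n -> f w * phiN c n e = phiN f n e * c w.
  move=> Kf wn; have [|a Ia] := He (word_delta w).
    by move=> v vn; rewrite /word_delta; case: eqP => // vw; rewrite vw wn eqxx in vn.
  have evE g : phiN g n (fun v => word_delta w v - a * e v) = g w - a * phiN g n e.
    have := phiN_delta n w g; rewrite wn leqnn mul1r => <-.
    rewrite !phiN_short_word mulr_sumr -sumrB; apply: eq_bigr => t _.
    by rewrite mulrBr mulrCA /word_delta eq_sym [X in X - _]mulrC.
  have /eqP := phiN_in_ideal n Kf Ia; rewrite evE subr_eq0 => /eqP ->.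
  have /eqP := phiN_in_ideal n Kc Ia; rewrite evE subr_eq0 => /eqP ->.
  by ring.
exists (fun w => (size w == n)%:R * (c w / c y0)), (val y0).
have Kc' : Ann (fun w => c w / c y0).
  move=> u v r /(Kc u v) H; under eq_bigr do under eq_bigr do rewrite mulrA.
  under eq_bigr do rewrite -mulr_suml.
  by rewrite -mulr_suml H mul0r.
split=> [|w /negPf ->|||f Kf w wn].
- exact: annihilates_degree.
- by rewrite mul0r.
- exact: size_tuple.
- by rewrite size_tuple eqxx mul1r divff.
rewrite wn eqxx mul1r.
apply: (mulIf ce); rewrite (prop _ _ Kf wn) mulrAC (prop _ _ Kf (size_tuple y0)).
by rewrite -!mulrA; congr (_ * _); rewrite mulrCA divff ?mulr1.
Qed.

Variables (psi : word -> k) (y0 : word).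
Hypotheses (Kpsi : Ann psi) (psi0 : forall w, size w != n -> psi w = 0).
Hypotheses (y0n : size y0 = n) (psi_y0 : psi y0 = 1).
Hypothesis psi_spans : forall f, Ann f -> forall w, size w = n -> f w = f y0 * psi w.

Let psi_y0_neq0 : psi y0 != 0. Proof. by rewrite psi_y0 oner_neq0. Qed.

(** Any form [f] is a multiple of [psi] on degree n after fixing a prefix, so testing [E] against
    the translates of [psi] by words of length n - t suffices. *)
Lemma top_nondegenerate_left t E : linear_form E -> degree_form t E -> (t <= n)%N ->
  (forall y, size y = (n - t)%N -> E (fun w => psi (y ++ w)) = 0) ->
  forall f, Ann f -> E f = 0.
Proof.
move=> linE degE tn E0; apply: (hecke_nondegenerate_left HR Kpsi psi0 y0n psi_y0_neq0 linE degE).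
(* The first m letters of [y] are the excess absorbed into the form, leaving exactly n - t. *)
move=> f y Kf ny; set m := (size y - (n - t))%N.
have dE : size (drop m y) = (n - t)%N by rewrite size_drop subKn.
rewrite (degree_form_ext linE degE (g := fun w => f (take m y ++ y0) * psi (drop m y ++ w))).
  by rewrite linear_formZ // E0 ?mulr0.
move=> w wt; rewrite -{1}(cat_take_drop m y) -catA.
by rewrite (psi_spans (annihilates_catl (take m y) Kf)) // size_cat dE wt subnK.
Qed.

Lemma top_nondegenerate_right t E : linear_form E -> degree_form t E -> (t <= n)%N ->
  (forall y, size y = (n - t)%N -> E (fun w => psi (w ++ y)) = 0) ->
  forall f, Ann f -> E f = 0.
Proof.
move=> linE degE tn E0; apply: (hecke_nondegenerate_right HR Kpsi psi0 y0n psi_y0_neq0 linE degE).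
move=> f y Kf ny; set m := (n - t)%N.
have tE : size (take m y) = (n - t)%N by rewrite size_takel.
rewrite (degree_form_ext linE degE (g := fun w => f (y0 ++ drop m y) * psi (w ++ take m y))).
  by rewrite linear_formZ // E0 ?mulr0.
move=> w wt; rewrite -{1}(cat_take_drop m y) catA.
by rewrite (psi_spans (annihilates_catr (drop m y) Kf)) // size_cat tE wt subnKC.
Qed.

(* If some [f] in [Ann] lived in degree [n + 1], comparing its first-letter and
   last-letter slices, both multiples of [psi], would make [psi (u a)] and [psi (u b)]
   proportional in [u], giving a nonzero vector killed by left multiplication. *)
Lemma annihilates_above_top f w : (1 < d)%N -> (0 < n)%N -> Ann f -> (n < size w)%N -> f w = 0.
Proof.
move=> d1 n0 Kf nw; rewrite -(cat_take_drop n.+1 w).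
have := annihilates_catr (drop n.+1 w) Kf; move: (f) => f0.
have : size (take n.+1 w) = n.+1 by rewrite size_takel.
move: (take n.+1 w) => w0 w0n {Kf}.
set g := fun w' => f0 (w' ++ drop n.+1 w); move=> Kg; rewrite -/(g w0).
have al c u : size u = n -> g (c :: u) = g (c :: y0) * psi u.
  exact: (psi_spans (annihilates_catl [:: c] Kg)).
have be a u : size u = n -> g (rcons u a) = g (rcons y0 a) * psi u.
  by rewrite -!cats1; exact: (psi_spans (annihilates_catr [:: a] Kg)).
apply/eqP/negPn/negP => gw0.
have [c cy0] : exists c, g (c :: y0) != 0.
  case: w0 w0n gw0 => [//|c u] [un]; rewrite al // mulf_eq0 negb_or => /andP[cy0 _].
  by exists c.
have [a ay0] : exists a, g (rcons y0 a) != 0.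
  case/lastP: w0 w0n gw0 => [//|u a]; rewrite size_rcons => -[un].
  by rewrite be // mulf_eq0 negb_or => /andP[ay0 _]; exists a.
(* Evaluating [g] on c u e by its first and by its last letter relates [psi (rcons u e)] to
   [psi (c :: u)]; comparing e = a and e = b eliminates the latter. *)
have prop b u : size u = n.-1 ->
    g (rcons y0 a) * psi (rcons u b) = g (rcons y0 b) * psi (rcons u a).
  move=> un; have ab e : g (c :: y0) * psi (rcons u e) = g (rcons y0 e) * psi (c :: u).
    by rewrite -al ?size_rcons ?un ?prednK // -rcons_cons be //= un prednK.
  by apply: (mulfI cy0); rewrite mulrCA ab mulrCA [RHS]mulrCA ab; ring.
have [b nba] : exists b, b != a.
  case: (eqVneq a (Ordinal (ltnW d1))) => [->|na]; last first.
    by exists (Ordinal (ltnW d1)); rewrite eq_sym.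
  by exists (Ordinal d1).
(* Evaluation at the degree 1 vector g(y0 a) e_b - g(y0 b) e_a, nonzero since b differs from a, and
   killed by [psi] after every left multiplication by degree n - 1. *)
pose E (h : word -> k) := g (rcons y0 a) * h [:: b] - g (rcons y0 b) * h [:: a].
have linE : linear_form E.
  move=> I x h; rewrite /E !mulr_sumr -sumrB; apply: eq_bigr => i _.
  by rewrite mulrBr; congr (_ - _); rewrite mulrCA.
have degE : degree_form 1 E by move=> h h0; rewrite /E !h0 // !mulr0 subrr.
(* Relations start in degree 2, so the coordinate form of e_b annihilates the ideal. *)
have Kb : Ann (word_delta [:: b]).
  move=> u v r _; apply: big1 => x _; apply: big1 => y _; rewrite /word_delta.
  by case: eqP => [/(f_equal size)|]; rewrite ?mulr0 // size_cat /=; lia.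
have Eb : E (word_delta [:: b]) = 0.
  apply: (top_nondegenerate_left linE degE n0) => // y yn.
  by rewrite /E !cats1 prop ?subrr // yn subn1.
move: Eb; rewrite /E /word_delta eqxx eqseq_cons [a == b]eq_sym (negPf nba).
by rewrite mulr1 mulr0 subr0 => /eqP; rewrite (negPf ay0).
Qed.

End Top.

End Annihilators.

(** * Vanishing above degree n and the Frobenius form *)

Theorem theorem2p8 (k : fieldType) (d : nat)
    (Rc : 'I_d -> 'I_d -> 'I_d -> 'I_d -> k) (q : k) (n : nat) :
  (1 < d)%N -> hecke_symmetry Rc q -> (0 < n)%N -> Lambda_dim1 Rc q n ->
  (forall i : nat, (n < i)%N -> Lambda_zero Rc q i) /\
  frobenius_quot (in_ideal Rc q).
Proof.
move=> d1 HR n0 dim1.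
have [psi [y0 [Kpsi psi0 y0n psi_y0 psi_spans]]] := top_functional dim1.
have above f w := annihilates_above_top HR Kpsi psi0 y0n psi_y0 psi_spans d1 n0 (f := f) (w := w).
split; first move=> i ni f fi.
  apply: (@in_ideal_dual _ _ _ _ i) => [w iw|c Kc]; first by apply: fi; rewrite gtn_eqF.
  rewrite phiN_short_word big1 // => t _; case: (eqVneq (size (word_of t)) i) => [ti|/fi ->].
    by rewrite (above c) ?mul0r // ti.
  by rewrite mulr0.
split.
  (* Words of length at most n span the quotient, as annihilating forms vanish on longer words. *)
  exists [seq word_delta k (word_of t) | t <- enum (short_word d n)]; split.
    move=> f /(proj1 (List.in_map_iff _ _ _)) [t [<- _]]; exists n => w nw.
    rewrite /word_delta; case: eqP nw => // ->; have := ltn_ord (tag t).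
    by rewrite /word_of size_tuple ltnS leqNgt => /negPf ->.
  move=> a N aN; exists [seq a (word_of t) | t <- enum (short_word d n)].
  rewrite zip_map.
  have sumE w : \sum_(p <- [seq (a (word_of t), word_delta k (word_of t)) |
      t <- enum (short_word d n)]) p.1 * p.2 w = (size w <= n)%N%:R * a w.
    rewrite big_map big_enum /= -phiN_delta phiN_short_word.
    by apply: eq_bigr => t _; rewrite mulrC.
  apply: (@in_ideal_dual _ _ _ _ N) => [w Nw|c Kc]; first by rewrite sumE (aN w Nw) mulr0 subrr.
  rewrite phiN_short_word big1 // => t _; rewrite sumE.
  case: leqP => [_|nt]; first by rewrite mul1r subrr mulr0.
  by rewrite (above c) ?mul0r.
exists psi; split=> [f N _|a Na aNa nIa]; first exact: phiN_in_ideal.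
(* Evaluation at the degree t component of [a]. *)
pose E t (f : seq 'I_d -> k) := \sum_(x : t.-tuple 'I_d) a x * f x.
have linE t : linear_form (E t).
  move=> I c f; rewrite /E; under eq_bigr do rewrite mulr_sumr.
  rewrite exchange_big; apply: eq_bigr => i _; rewrite mulr_sumr.
  by apply: eq_bigr => x _; rewrite mulrCA.
have degE t : degree_form t (E t).
  by move=> f f0; apply: big1 => x _; rewrite f0 ?mulr0 ?size_tuple.
(* Otherwise every annihilating form would kill [a], degrees above n contributing nothing, and
   duality would put [a] in the ideal. *)
have contra : ~ forall t f, (t <= n)%N -> annihilates (kerRq Rc q) f -> E t f = 0.
  move=> E0; apply: nIa; apply: (in_ideal_dual aNa) => c Kc; apply: big1 => t _.
  case: (leqP t n) => [tn|nt].
    by rewrite -[RHS](E0 t c tn Kc); apply: eq_bigr => x _; rewrite mulrC.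
  by apply: big1 => x _; rewrite (above c) ?mul0r // size_tuple.
have bd m y : (m <= n)%N -> size y = m -> bounded (word_delta k y) n.
  move=> mn ym w nw; rewrite /word_delta; case: eqP nw => // ->.
  by rewrite ym ltnNge mn.
(* Basis words of length n - t serve as the second factor: if [psi] killed all these products,
   nondegeneracy would make [E t] vanish on the annihilator. *)
split; apply: NNPP => no; apply: contra => t f tn Kf.
  apply: (top_nondegenerate_right HR Kpsi psi0 y0n psi_y0 psi_spans (linE t) (degE t) tn) => // y yn.
  rewrite /E -(phiN_tmul_deltar a psi0 (leq_addl Na n) tn yn).
  apply/eqP/negPn/negP => nz; apply: no; exists (word_delta k y), n; split=> //.
  exact: bd (leq_subr t n) yn.
apply: (top_nondegenerate_left HR Kpsi psi0 y0n psi_y0 psi_spans (linE t) (degE t) tn) => // y yn.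
rewrite /E -(phiN_tmul_deltal a psi0 (leq_addr Na n) tn yn).
apply/eqP/negPn/negP => nz; apply: no; exists (word_delta k y), n; split=> //.
exact: bd (leq_subr t n) yn.
Qed.
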